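(* Let $p\ge 1$ be an integer, $N\in\mathbb{Z}_+$, $\bar a_k,\bar b_k\in\mathbb{R}$, $\bar q_k>0$, $\bar r_k>0$ for $k\in\{0,\dots,N-1\}$, $\bar q_N>0$, and let $\bar x_0\in\mathbb{R}$ be given. Consider the problem of minimizing $$L(\bar x_0,\bar u)=\bar q_N\bar x_N^{2p}+\sum_{k=0}^{N-1}\left(\bar q_k\bar x_k^{2p}+\bar r_k\bar u_k^{2p}\right)$$ over admissible controls $\bar u=(\bar u_k)_{k\in\{0,\dots,N-1\}}$, subject to $$\bar x_{k+1}=\bar a_k\bar x_k+\bar b_k\bar u_k,\qquad k\in\{0,\dots,N-1\}.$$ Then the optimal control input is $$\bar u_k^*=-\frac{\left(\frac{\bar\alpha_{k+1}\bar b_k}{\bar r_k}\right)^{1/(2p-1)}\bar a_k}{1+\left(\frac{\bar\alpha_{k+1}\bar b_k}{\bar r_k}\right)^{1/(2p-1)}\bar b_k}\,\bar x_k,\qquad k\in\{0,\dots,N-1\},$$ where $\bar\alpha$ solves the backward recursive equation $$\bar\alpha_k=\bar q_k+\bar r_k\left(\frac{\left(\frac{\bar\alpha_{k+1}\bar b_k}{\bar r_k}\right)^{1/(2p-1)}\bar a_k}{1+\left(\frac{\bar\alpha_{k+1}\bar b_k}{\bar r_k}\right)^{1/(2p-1)}\bar b_k}\right)^{2p}+\bar\alpha_{k+1}\left(\bar a_k-\bar b_k\frac{\left(\frac{\bar\alpha_{k+1}\bar b_k}{\bar r_k}\right)^{1/(2p-1)}\bar a_k}{1+\left(\frac{\bar\alpha_{k+1}\bar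 b_k}{\bar r_k}\right)^{1/(2p-1)}\bar b_k}\right)^{2p},\quad k\in\{0,\dots,N-1\},$$ with terminal condition $\bar\alpha_N=\bar q_N$.
   Context: All quantities are real and $(\cdot)^{1/(2p-1)}$ denotes the real odd root (defined also for negative arguments). Admissible controls are sequences $(\bar u_k)_{k\in\{0,\dots,N-1\}}$ of real-valued Lebesgue measurable controls (with $\bar u_k^{2p}<+\infty$), restricted to state-feedback form $\bar u_k=\bar u_k(\bar x_k)$, i.e. $\bar u_k$ is a function of the current state $\bar x_k$ only. ''Optimal'' means attaining the minimum of the cost over admissible controls. *)

(* Defs.v *)
From HB Require Import structures.
From mathcomp Require Export all_boot all_order all_algebra.
From mathcomp Require Export all_classical all_reals all_analysis.
From mathcomp Require Export measurable_realfun.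

Set Implicit Arguments.
Unset Strict Implicit.
Unset Printing Implicit Defensive.

Import Order.TTheory GRing.Theory Num.Theory.
Import numFieldNormedType.Exports.

Local Open Scope classical_set_scope.
Local Open Scope ring_scope.

(* The real m-th root for odd m, negative arguments included; [oddrootK] is
   its defining property. *)
Definition oddroot {R : realType} (m : nat) (x : R) : R :=
  Num.sg x * `|x| `^ (m%:R^-1).

Lemma oddrootK {R : realType} (m : nat) (x : R) :
  odd m -> oddroot m x ^+ m = x.
Proof.
move=> om; have m0 : (m%:R : R) != 0 by rewrite pnatr_eq0; case: m om.
rewrite /oddroot exprMn -[_ `^ _ ^+ _]powR_mulrn ?powR_ge0//.
rewrite -powRrM mulVf// powRr1//.
have [x0|x0|->] := ltrgt0P x; last by rewrite mulr0.
  by rewrite gtr0_sg// expr1n mul1r.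
by rewrite ltr0_sg// -signr_odd om expr1 mulN1r opprK.
Qed.

(* [measurable_fun] on R itself refers to the Borel sigma-algebra; here the
   domain carries its completion, i.e. the Lebesgue sigma-algebra. *)
Definition lebesgue_measurable_fun {R : realType} (f : R -> R) : Prop :=
  measurable_fun
    [set: g_sigma_algebraType (completed_algebra_gen (@lebesgue_measure R))] f.

(* State-feedback controls: [u k x] is the input applied at stage k in state x.
   The requirement that u_k ^ (2p) be finite holds because u_k is real-valued.
   Only the stages k < N matter, here and in [cost]. *)
Definition admissible {R : realType} (N : nat) (u : nat -> R -> R) : Prop :=
  forall k, (k < N)%N -> lebesgue_measurable_fun (u k).

Fixpoint state {R : realType} (a b : nat -> R) (u : nat -> R -> R) (x0 : R)
    (k : nat) : R :=
  if k is j.+1 then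
    a j * state a b u x0 j + b j * u j (state a b u x0 j)
  else x0.

Definition input {R : realType} (a b : nat -> R) (u : nat -> R -> R) (x0 : R)
    (k : nat) : R :=
  u k (state a b u x0 k).

Definition cost {R : realType} (p N : nat) (a b q r : nat -> R) (x0 : R)
    (u : nat -> R -> R) : R :=
  q N * state a b u x0 N ^+ (2 * p) +
  \sum_(k < N) (q k * state a b u x0 k ^+ (2 * p) +
                r k * input a b u x0 k ^+ (2 * p)).

Definition optimal {R : realType} (p N : nat) (a b q r : nat -> R) (x0 : R)
    (u : nat -> R -> R) : Prop :=
  admissible N u /\
  forall v, admissible N v ->
    cost p N a b q r x0 u <= cost p N a b q r x0 v.

Definition gain {R : realType} (p : nat) (a b r alpha : R) : R :=
  oddroot (2 * p - 1) (alpha * b / r) * a /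
  (1 + oddroot (2 * p - 1) (alpha * b / r) * b).

(* Main.v *)
Require Import Defs.
From mathcomp Require Import ring.

Import Order.TTheory GRing.Theory Num.Theory.
Import numFieldNormedType.Exports.
Local Open Scope ring_scope.

(** The proof is dynamic programming with value function
    V_k(x) = alpha_k x^(2p).

    At a single stage, write s for the odd root of alpha_(k+1) b / r and g for
    the gain.  The number 1 + s b is positive because s and b have the same
    sign, so the input w* = - g x and the next state y* = (a - b g) x satisfy
    w* = - s y*.  As s^(2p-1) = alpha_(k+1) b / r and 2p - 1 is odd, this gives
    r w*^(2p-1) + alpha_(k+1) b y*^(2p-1) = 0, which is the first-order
    condition for the strictly convex function
    w |-> r w^(2p) + alpha_(k+1) (a x + b w)^(2p).  The tangent inequality for
    even powers turns it into global minimality with unique minimizer w*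
    ([stage_cost_lt]), and the recursion for alpha says that the minimum is
    (alpha_k - q_k) x^(2p).

    Telescoping V_k along a trajectory ([costE_stage_gaps]) writes the cost of
    any control as V_0(x_0) plus the sum over the stages of the difference
    between what the stage costs and its minimum.  These gaps are nonnegative
    and all vanish for the feedback - g_k x, which is therefore optimal; for an
    optimal control they must all vanish, which by uniqueness forces the input
    at every stage. *)

Lemma bernoulli_ge0 (R : realFieldType) (n : nat) (t c : R) :
  0 <= t -> 0 <= c ->
  c ^+ n.+1 + n.+1%:R * c ^+ n * (t - c) <= t ^+ n.+1.
Proof.
move=> t0 c0; elim: n => [|n IH].
  by rewrite !expr1 expr0 !mul1r addrC subrK.
rewrite [leRHS]exprS; apply: le_trans (ler_wpM2l t0 IH).
rewrite -subr_ge0.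
have -> : t * (c ^+ n.+1 + n.+1%:R * c ^+ n * (t - c)) -
  (c ^+ n.+2 + n.+2%:R * c ^+ n.+1 * (t - c)) =
  n.+1%:R * c ^+ n * (t - c) ^+ 2.
  rewrite !exprS -!natr1; ring.
by rewrite mulr_ge0 ?sqr_ge0// mulr_ge0 ?exprn_ge0.
Qed.

(** Since t^2 - c^2 - 2 c (t - c) = (t - c)^2, Bernoulli's inequality at t^2
    and c^2 leaves a surplus of (n+1) c^(2n) (t - c)^2.  It is positive unless
    c = 0, a case where the right-hand side alone is positive. *)
Lemma even_power_tangent_lt (R : realFieldType) (n : nat) (t c : R) :
  t != c ->
  c ^+ (2 * n.+1) + (2 * n.+1)%:R * c ^+ (2 * n).+1 * (t - c)
    < t ^+ (2 * n.+1).
Proof.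
move=> tc; rewrite !exprM.
have tc2 : 0 < (t - c) ^+ 2 by rewrite exprn_even_gt0// subr_eq0 tc.
have [c0|c0] := eqVneq c 0.
  rewrite c0 !expr0n/= mulr0 mul0r addr0.
  by rewrite exprn_gt0// exprn_even_gt0//= -c0.
have := bernoulli_ge0 _ n (t ^+ 2) (c ^+ 2) (sqr_ge0 _) (sqr_ge0 _).
apply: lt_le_trans; rewrite -subr_gt0.
have -> : (c ^+ 2) ^+ n.+1 + n.+1%:R * (c ^+ 2) ^+ n * (t ^+ 2 - c ^+ 2) -
  ((c ^+ 2) ^+ n.+1 + (2 * n.+1)%:R * c ^+ (2 * n).+1 * (t - c)) =
  n.+1%:R * (c ^+ 2) ^+ n * (t - c) ^+ 2.
  rewrite natrM [c ^+ (2 * n).+1]exprS [c ^+ (2 * n)]exprM; ring.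
by rewrite mulr_gt0// mulr_gt0// exprn_gt0// exprn_even_gt0.
Qed.

Lemma oddroot_mulr_ge0 (R : realType) (m : nat) (c b : R) :
  0 <= c -> 0 <= oddroot m (c * b) * b.
Proof.
move=> c0; rewrite /oddroot mulrAC mulr_ge0 ?powR_ge0//.
by rewrite sgrM -mulrA -normrEsg mulr_ge0// sgr_ge0.
Qed.

(** This is the relation w* = - s y* between the optimal input and the next
    state, without the common factor - x. *)
Lemma gainE (R : realType) (p : nat) (a b r alpha : R) :
  0 < r -> 0 < alpha ->
  gain p a b r alpha =
  oddroot (2 * p - 1) (alpha * b / r) * (a - b * gain p a b r alpha).
Proof.
move=> r0 al0; rewrite /gain; set s := oddroot _ _.
have sb : 0 <= s * b.
  by rewrite /s [alpha * b / r]mulrAC oddroot_mulr_ge0// divr_ge0// ltW.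
have d0 : 1 + s * b != 0 by rewrite gt_eqF// ltr_wpDr.
by field.
Qed.

Lemma stage_cost_feedback (R : comNzRingType) (p : nat)
    (a b r alpha g x : R) :
  r * (- g * x) ^+ (2 * p) + alpha * (a * x + b * (- g * x)) ^+ (2 * p) =
  (r * g ^+ (2 * p) + alpha * (a - b * g) ^+ (2 * p)) * x ^+ (2 * p).
Proof.
have -> : a * x + b * (- g * x) = (a - b * g) * x by ring.
by rewrite mulNr [(- _) ^+ _]exprM sqrrN -exprM !exprMn mulrDl !mulrA.
Qed.

(** The left-hand side is the stage cost at the feedback input [us], with next
    state [ys].  Adding the tangent inequalities of the two even powers at
    [us] and [ys] bounds the cost at [w] from below by that value plus a
    multiple of the first-order condition [stat], hence by that value; the
    inequality at [us] is strict. *)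
Lemma stage_cost_lt (R : realType) (p : nat) (a b r alpha x w : R) :
  (1 <= p)%N -> 0 < r -> 0 < alpha -> w != - gain p a b r alpha * x ->
  (r * gain p a b r alpha ^+ (2 * p) +
   alpha * (a - b * gain p a b r alpha) ^+ (2 * p)) * x ^+ (2 * p)
  < r * w ^+ (2 * p) + alpha * (a * x + b * w) ^+ (2 * p).
Proof.
case: p => // p _ r0 al0; have := gainE _ p.+1 a b _ _ r0 al0.
set g := gain _ _ _ _ _; set s := oddroot _ _ => gs wg.
have sm : s ^+ (2 * p).+1 = alpha * b / r.
  rewrite /s mulnS -addnBAC// subn1 add1n oddrootK//.
  by rewrite /= oddM.
rewrite -stage_cost_feedback.
have -> : a * x + b * (- g * x) = (a - b * g) * x by ring.
set us := - g * x; set ys := (a - b * g) * x.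
have wl := even_power_tangent_lt _ p _ _ wg; rewrite -/us in wl.
have yl : ys ^+ (2 * p.+1) +
    (2 * p.+1)%:R * ys ^+ (2 * p).+1 * (a * x + b * w - ys)
    <= (a * x + b * w) ^+ (2 * p.+1).
  have [->|/(even_power_tangent_lt _ p)/ltW//] := eqVneq (a * x + b * w) ys.
  by rewrite subrr mulr0 addr0.
have stat : r * us ^+ (2 * p).+1 + alpha * b * ys ^+ (2 * p).+1 = 0.
  have -> : us = - (s * ys) by rewrite /us /ys {1}gs; ring.
  rewrite exprNn -signr_odd/= oddM/= expr1 exprMn sm.
  by field; rewrite gt_eqF.
have -> : r * us ^+ (2 * p.+1) + alpha * ys ^+ (2 * p.+1) =
    r * (us ^+ (2 * p.+1) + (2 * p.+1)%:R * us ^+ (2 * p).+1 * (w - us)) +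
    alpha * (ys ^+ (2 * p.+1) +
      (2 * p.+1)%:R * ys ^+ (2 * p).+1 * (a * x + b * w - ys)).
  have -> : a * x + b * w - ys = b * (w - us) by rewrite /us /ys; ring.
  have e : r * ((2 * p.+1)%:R * us ^+ (2 * p).+1 * (w - us)) +
    alpha * ((2 * p.+1)%:R * ys ^+ (2 * p).+1 * (b * (w - us))) = 0.
    transitivity ((2 * p.+1)%:R * (w - us) *
      (r * us ^+ (2 * p).+1 + alpha * b * ys ^+ (2 * p).+1)); first by ring.
    by rewrite stat mulr0.
  by rewrite mulrDr [alpha * (_ + _)]mulrDr addrACA e addr0.
by apply: ltr_leD; [rewrite ltr_pM2l | rewrite ler_pM2l].
Qed.

Lemma stage_cost_le (R : realType) (p : nat) (a b r alpha x w : R) :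
  (1 <= p)%N -> 0 < r -> 0 < alpha ->
  (r * gain p a b r alpha ^+ (2 * p) +
   alpha * (a - b * gain p a b r alpha) ^+ (2 * p)) * x ^+ (2 * p)
  <= r * w ^+ (2 * p) + alpha * (a * x + b * w) ^+ (2 * p).
Proof.
move=> p0 r0 al0; have [->|wg] := eqVneq w (- gain p a b r alpha * x).
  by rewrite stage_cost_feedback.
exact/ltW/stage_cost_lt.
Qed.

(** Linear maps are Borel, and a Borel set is its own union with the
    negligible set [set0], so it belongs to the completed sigma-algebra. *)
Lemma lebesgue_measurable_mulrl (R : realType) (c : R) :
  lebesgue_measurable_fun (fun x : R => c * x).
Proof.
move=> _ Y mY; rewrite setTI.
apply: sub_sigma_algebra; exists (preimage (fun x : R => c * x) Y).
  rewrite -[X in measurable X]setTI.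
  have mc : measurable_fun [set: R] ( *%R c) by exact: mulrl_measurable.
  exact: mc.
by exists set0; [exact: negligible_set0 | rewrite setU0].
Qed.

(** The summand at [k] is the cost-to-go r_k u_k^(2p) + V_(k+1)(x_(k+1)) of
    the stage in excess of V_k(x_k) - q_k x_k^(2p).  The identity is pure
    telescoping, for any coefficients [alpha] with the right terminal value. *)
Lemma costE_stage_gaps (R : realType) (p N : nat) (a b q r alpha : nat -> R) (x0 : R)
    (u : nat -> R -> R) :
  alpha N = q N ->
  cost p N a b q r x0 u = alpha 0%N * x0 ^+ (2 * p) +
    \sum_(k < N) (r k * input a b u x0 k ^+ (2 * p) +
      alpha k.+1 * state a b u x0 k.+1 ^+ (2 * p) -
      (alpha k - q k) * state a b u x0 k ^+ (2 * p)).
Proof.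
move=> aN; pose V k := alpha k * state a b u x0 k ^+ (2 * p).
have tele : \sum_(k < N) (V k.+1 - V k) = V N - V 0%N.
  by rewrite -(telescope_sumr V (leq0n N)) big_mkord.
rewrite /cost -aN -/(V N) -/(V 0%N).
rewrite [X in _ = _ + X](_ : _ = \sum_(k < N) (V k.+1 - V k) +
  \sum_(k < N) (q k * state a b u x0 k ^+ (2 * p) +
                r k * input a b u x0 k ^+ (2 * p))).
  by rewrite tele addrA subrKC.
by rewrite -big_split; apply: eq_bigr => k _; rewrite /V /=; ring.
Qed.

Theorem proposition2 (R : realType) (p N : nat) (a b q r : nat -> R) (x0 : R)
    (alpha : nat -> R)
    (hp : (1 <= p)%N)
    (hq : forall k, (k < N)%N -> 0 < q k)
    (hr : forall k, (k < N)%N -> 0 < r k)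
    (hqN : 0 < q N)
    (halphaN : alpha N = q N)
    (halpha : forall k, (k < N)%N ->
       alpha k = q k
         + r k * gain p (a k) (b k) (r k) (alpha k.+1) ^+ (2 * p)
         + alpha k.+1 *
             (a k - b k * gain p (a k) (b k) (r k) (alpha k.+1)) ^+ (2 * p)) :
  optimal p N a b q r x0
    (fun k x => - gain p (a k) (b k) (r k) (alpha k.+1) * x) /\
  (forall u, optimal p N a b q r x0 u -> forall k, (k < N)%N ->
     input a b u x0 k =
       - gain p (a k) (b k) (r k) (alpha k.+1) * state a b u x0 k).
Proof.
have even_ge0 (y : R) : 0 <= y ^+ (2 * p) by rewrite exprM exprn_ge0 ?sqr_ge0.
(* Backward induction: every alpha_k is at least q_k. *)
have alpha_gt0 k : (k <= N)%N -> 0 < alpha k.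
  move=> kN; rewrite -(subKn kN); elim: (N - k)%N (leq_subr k N) => [|j IH] jN.
    by rewrite subn0 halphaN.
  have jE : (N - j.+1).+1 = (N - j)%N by rewrite subnSK.
  have lt : (N - j.+1 < N)%N by rewrite jE leq_subr.
  have a0 := IH (ltnW jN).
  rewrite halpha// jE -addrA ltr_wpDr ?hq//.
  by rewrite addr_ge0// mulr_ge0// ltW// hr.
pose G k := gain p (a k) (b k) (r k) (alpha k.+1).
pose ustar : nat -> R -> R := fun k x => - G k * x.
pose gap u k := r k * input a b u x0 k ^+ (2 * p) +
      alpha k.+1 * state a b u x0 k.+1 ^+ (2 * p) -
      (alpha k - q k) * state a b u x0 k ^+ (2 * p).
have costE u : cost p N a b q r x0 u =
    alpha 0%N * x0 ^+ (2 * p) + \sum_(k < N) gap u k by exact: costE_stage_gaps.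
have alphaB k : (k < N)%N -> alpha k - q k =
    r k * G k ^+ (2 * p) + alpha k.+1 * (a k - b k * G k) ^+ (2 * p).
  by move=> kN; rewrite halpha// -/(G k); ring.
have gap_ge0 u k : (k < N)%N -> 0 <= gap u k.
  move=> kN; rewrite subr_ge0 alphaB//.
  by apply: stage_cost_le; rewrite ?hr ?alpha_gt0.
have gap_gt0 u k : (k < N)%N ->
    input a b u x0 k != - G k * state a b u x0 k -> 0 < gap u k.
  move=> kN ne; rewrite subr_gt0 alphaB//.
  by apply: stage_cost_lt; rewrite ?hr ?alpha_gt0.
have cost_star : cost p N a b q r x0 ustar = alpha 0%N * x0 ^+ (2 * p).
  rewrite costE big1 ?addr0// => k _; apply/eqP; rewrite subr_eq0 alphaB//.
  by rewrite /= /input /ustar stage_cost_feedback.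
have adm_star : admissible N ustar.
  by move=> k _; exact: lebesgue_measurable_mulrl.
split.
  split => // v _; rewrite cost_star costE lerDl.
  by apply: sumr_ge0 => k _; exact: gap_ge0.
move=> u [_ /(_ _ adm_star)]; rewrite cost_star costE gerDl => sum_le0 k kN.
apply/eqP/negP => /negP/(gap_gt0 _ _ kN) gk.
move: sum_le0; apply/negP; rewrite -ltNge (bigD1 (Ordinal kN))//= ltr_wpDr//.
by apply: sumr_ge0 => i _; exact: gap_ge0.
Qed.
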